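(* For every classical-quantum state $\rho_{XB}=\sum_x p_x|x\rangle\langle x|_X\otimes\rho_B^x$ (with $(p_x)_x$ a probability distribution and $\rho_B^x$ quantum states on $B$), $$\overset{c}{H}_{\min}(X|B)_\rho=-\log\overset{c}{p}_{\mathrm{guess}}(X|B)_\rho,\qquad \overset{c}{p}_{\mathrm{guess}}(X|B)_\rho:=\max_{\{E_B^x\}_x\in\mathbf M^{p(n)}_{n,|X|}}\ \sum_x p_x\,\mathrm{Tr}[E_B^x\rho_B^x],$$ where $\mathbf M^{p(n)}_{n,|X|}$ is the set of efficiently implementable $|X|$-outcome POVMs on $B$.
   Context: All Hilbert spaces are finite-dimensional and $\log$ is base $2$. Fix a finite gate set $\mathcal G$ (each gate is a unitary acting on a bounded number of registers) and a polynomial $p$. For a fixed $n$, $X$ and $B$ are systems consisting of registers, $|X|=\dim\mathcal H_X$, $X'\cong X$, and $|\Omega_{XX'}\rangle=\frac1{\sqrt{|X|}}\sum_{x}|x\rangle_X|x\rangle_{X'}$ in the computational basis. For a quantum channel (CPTP map) $T:\mathcal B(\mathcal H_B)\to\mathcal B(\mathcal H_{X'})$, $T^*$ denotes its adjoint, $\mathrm{Tr}[T(\rho)Y]=\mathrm{Tr}[\rho\,T^*(Y)]$. The gate complexity $C(T)$ is the minimal number of gates from $\mathcal G$ in a unitary circuit $U:\mathcal H_B\otimes\mathcal H_E\to\mathcal H_{X'}\otimes\mathcal H_K$ (for some ancillary systems $E,K$ of matching total dimension) such that $T(\rho)=\mathrm{tr}_K[U(\rho\otimes|0\rangle\langle0|_E)U^*]$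 for all $\rho$. $\mathbf M^{p(n)}_{n,|X|}$ is the set of POVMs $\{E_B^x\}_{x}$ on $B$ that can be implemented by applying such a unitary circuit $U$ with at most $p(n)$ gates to $B$ and ancillas initialized in $|0\rangle$, followed by measuring the output register $X'$ in the computational basis, i.e. $E_B^x=\langle0|_E\,U^*(|x\rangle\langle x|_{X'}\otimes\mathbb 1_K)\,U|0\rangle_E$. The Choi operator is $J(T^* ):=|X|(\mathrm{Id}_X\otimes T^* )(|\Omega_{XX'}\rangle\langle\Omega_{XX'}|)$ on $XB$. Let $\mathbf J:=\{J(T^* ):C(T)\le p(n)\}$ and let $\mathcal C^{E}:=\mathrm{cone}(\mathbf J)$ be the smallest convex cone containing it. Standing assumption (informational completeness): $\mathrm{span}_{\mathbb R}\mathbf J=\{Y\text{ Hermitian on }XB:\mathrm{tr}_X[Y]\in\mathbb R\cdot\mathbb 1_B\}$. For Hermitian $Y,Z$ on $XB$ write $Y\le_{S}Z$ iff $\mathrm{Tr}[YF]\le\mathrm{Tr}[ZF]$ for all $F\in\mathcal C^{E}$. Then $\overset{c}{D}{}^{X|B}_{\max}(\rho\|\sigma):=\inf\{\lambda\in\mathbb R:\rho\le_S2^\lambda\sigma\}$ (with $\inf\emptyset=+\infty$), and $$\overset{c}{H}_{\min}(X|B)_\rho:=-\inf_{\sigma_B\ge0,\ \mathrm{Tr}[\sigma_B]=1}\overset{c}{D}{}^{X|B}_{\max}(\rho_{XB}\|\mathbb 1_X\otimes\sigma_B).$$ *)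

(* Defs.v *)
From HB Require Import structures.
From mathcomp Require Import all_boot all_order all_algebra.
From mathcomp Require Import all_classical all_reals all_analysis.
From mathcomp Require Import complex mxtens.

Set Implicit Arguments.
Unset Strict Implicit.
Unset Printing Implicit Defensive.

Import Order.TTheory GRing.Theory Num.Theory.
Local Open Scope classical_set_scope.
Local Open Scope complex_scope.
Local Open Scope sesquilinear_scope.
Local Open Scope ring_scope.

(** * Operators on finite-dimensional Hilbert spaces

   Operators on C^m are matrices in 'M[R[i]]_m, where [R[i]] is the field of
   complex numbers over [R]; C^m ⊗ C^k is C^(m * k), with the Kronecker product
   [*t] and the index bijection [mxtens_index]. *)

Section Operators.
Variable R : realType.
Local Notation C := R[i].

Definition psd m (A : 'M[C]_m) : Prop :=
  A \is hermsymmx /\ forall v : 'cV[C]_m, 0 <= (v^t* *m A *m v) 0 0.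

Definition density m (rho : 'M[C]_m) : Prop := psd rho /\ \tr rho = 1.

Definition povm k m (E : 'I_k -> 'M[C]_m) : Prop :=
  (forall x, psd (E x)) /\ \sum_x E x = 1%:M.

(* tr_1 and tr_2 on C^m ⊗ C^k *)
Definition ptrace1 m k (A : 'M[C]_(m * k)) : 'M[C]_k :=
  \matrix_(i, j) \sum_a A (mxtens_index (a, i)) (mxtens_index (a, j)).

Definition ptrace2 m k (A : 'M[C]_(m * k)) : 'M[C]_m :=
  \matrix_(i, j) \sum_a A (mxtens_index (i, a)) (mxtens_index (j, a)).

(* Id ⊗ T: with A = \sum_(a, b) |a><b| ⊗ A_ab, the result is
   \sum_(a, b) |a><b| ⊗ T(A_ab). *)
Definition ampl k m m' (T : 'M[C]_m -> 'M[C]_m') (A : 'M[C]_(k * m)) :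
    'M[C]_(k * m') :=
  \sum_(a < k) \sum_(b < k) delta_mx a b *t
    T (\matrix_(i, j) A (mxtens_index (a, i)) (mxtens_index (b, j))).

Definition cptp m m' (T : {linear 'M[C]_m -> 'M[C]_m'}) : Prop :=
  (forall k (A : 'M[C]_(k * m)), psd A -> psd (ampl T A)) /\
  (forall A, \tr (T A) = \tr A).

(* The map T^* determined by Tr[T(rho) Y] = Tr[rho T^*(Y)], see [adjointP];
   its (i, j) entry is the case rho = |j><i|. *)
Definition adjoint m m' (T : 'M[C]_m -> 'M[C]_m') (Y : 'M[C]_m') : 'M[C]_m :=
  \matrix_(i, j) \tr (T (delta_mx j i) *m Y).

Lemma adjointP m m' (T : {linear 'M[C]_m -> 'M[C]_m'}) rho Y :
  \tr (T rho *m Y) = \tr (rho *m adjoint T Y).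
Proof.
rewrite {1}(matrix_sum_delta rho) linear_sum mulmx_suml linear_sum.
rewrite [RHS]/mxtrace; apply: eq_bigr => i _.
rewrite linear_sum mulmx_suml linear_sum mxE; apply: eq_bigr => j _.
by rewrite linearZ /= -scalemxAl linearZ /= mxE.
Qed.

(* |Omega> = m^(-1/2) \sum_x |x>|x> *)
Definition Omega m : 'cV[C]_(m * m) :=
  ((Num.sqrt (m%:R : R))^-1)%:C *:
    \sum_(x < m) (delta_mx x 0 : 'cV[C]_m) *t (delta_mx x 0 : 'cV[C]_m).

(* J(S) = m (Id ⊗ S)(|Omega><Omega|) *)
Definition choi m k (S : 'M[C]_m -> 'M[C]_k) : 'M[C]_(m * k) :=
  m%:R *: ampl S (Omega m *m (Omega m)^t*).

Definition convex_cone m (K : set 'M[C]_m) : Prop :=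
  K 0 /\ forall (a b : R) A B, 0 <= a -> 0 <= b -> K A -> K B ->
    K (a%:C *: A + b%:C *: B).

Definition real_subspace m (V : set 'M[C]_m) : Prop :=
  V 0 /\ forall (a b : R) A B, V A -> V B -> V (a%:C *: A + b%:C *: B).

Definition cone m (S : set 'M[C]_m) := smallest (@convex_cone m) S.

Definition real_span m (S : set 'M[C]_m) := smallest (@real_subspace m) S.

End Operators.

(** * Registers, gates and circuits *)

(* A finite list of registers, of possibly different dimensions. *)
Record system := System {
  nreg : nat;
  rdim : 'I_nreg -> nat;
  rdim_gt0 : forall r, (0 < rdim r)%N }.

Definition reg (S : system) := 'I_(nreg S).

(* computational basis states *)
Definition basis_state (S : system) := {dffun forall r : reg S, 'I_(rdim r)}.

Definition hdim (S : system) : nat := #|{: basis_state S}|.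

Lemma hdimE (S : system) : hdim S = (\prod_(r : reg S) rdim r)%N.
Proof.
rewrite /hdim card_dep_ffun foldrE big_image.
by under eq_bigr do rewrite card_ord.
Qed.

Definition zero_state (S : system) : basis_state S :=
  [ffun r : reg S => Ordinal (rdim_gt0 r)].

Definition sum_dim (S S' : system) (r : reg S + reg S') : nat :=
  match r with inl a => rdim a | inr b => rdim b end.

Lemma sum_dim_gt0 S S' (r : reg S + reg S') : (0 < sum_dim r)%N.
Proof. by case: r => r; exact: rdim_gt0. Qed.

(* The registers of S followed by those of S'. *)
Definition join (S S' : system) : system :=
  @System (nreg S + nreg S') (fun r => sum_dim (fintype.split r))
    (fun r => sum_dim_gt0 (fintype.split r)).

(* The basis state of [join S S'] corresponding to the basis vector |i> of
   H_S ⊗ H_S'. *)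
Definition sum_digit (S S' : system) (i : 'I_(hdim S * hdim S'))
    (r : reg S + reg S') : 'I_(sum_dim r) :=
  match r return 'I_(sum_dim r) with
  | inl a => (enum_val (mxtens_unindex i).1 : basis_state S) a
  | inr b => (enum_val (mxtens_unindex i).2 : basis_state S') b
  end.

Definition join_state (S S' : system) (i : 'I_(hdim S * hdim S')) :
    basis_state (join S S') := [ffun r : reg (join S S') => sum_digit i (fintype.split r)].

(* An assignment of the registers of [S'] to distinct registers of [S] of the
   same dimensions. *)
Record wiring (S S' : system) := Wiring {
  wire :> reg S' -> reg S;
  wire_inj : injective wire;
  wire_dim : forall r, rdim (wire r) = rdim r }.

Definition read_state (S S' : system) (w : wiring S S') (x : basis_state S) : basis_state S' :=
  [ffun r : reg S' => cast_ord (wire_dim w r) (x (w r))].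

Section Circuits.
Variable R : realType.
Local Notation C := R[i].

Record gate := Gate {
  gsys : system;
  gmx : 'M[C]_(hdim gsys);
  gmx_unitary : gmx \is unitarymx }.

(* The gate [g] on the registers of [S] selected by [w], tensored with the
   identity on the other registers. *)
Definition apply_gate (S : system) (g : gate) (w : wiring S (gsys g)) :
    'M[C]_(hdim S) :=
  \matrix_(i, j)
    let y := enum_val i : basis_state S in let x := enum_val j : basis_state S in
    if [forall r : reg S, (r \in codom w) || (y r == x r)]
    then gmx g (enum_rank (read_state w y)) (enum_rank (read_state w x)) else 0.

Variables (GI : finType) (G : GI -> gate).

Definition apply_gates (S : system)
    (s : seq {g : GI & wiring S (gsys (G g))}) : 'M[C]_(hdim S) :=
  foldr (fun a U => apply_gate (projT2 a) *m U) 1%:M s.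

(* A circuit from [S] to [S']: a list of gates on the registers of S and of an
   ancilla system, followed by a (free) identification of these registers with
   those of S' and of a discarded system. *)
Record circuit (S S' : system) := Circuit {
  anc : system;
  disc : system;
  gates : seq {g : GI & wiring (join S anc) (gsys (G g))};
  out : wiring (join S' disc) (join S anc);
  out_bij : bijective out }.

(* U : H_S ⊗ H_anc -> H_S' ⊗ H_disc *)
Definition circuit_mx (S S' : system) (c : circuit S S') :
    'M[C]_(hdim S' * hdim (disc c), hdim S * hdim (anc c)) :=
  \matrix_(i, j) apply_gates (gates c)
    (enum_rank (read_state (out c) (join_state i))) (enum_rank (join_state j)).

Definition ket0 (S : system) : 'cV[C]_(hdim S) :=
  delta_mx (enum_rank (zero_state S)) 0.

(* rho |-> tr_K [U (rho ⊗ |0><0|) U^*] *)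
Definition circuit_channel (S S' : system) (c : circuit S S')
    (rho : 'M[C]_(hdim S)) : 'M[C]_(hdim S') :=
  let U := circuit_mx c in
  ptrace2 (U *m (rho *t (ket0 (anc c) *m (ket0 (anc c))^t*)) *m U^t*).

(* C(T), equal to +oo if no circuit implements T. *)
Definition gate_complexity (S S' : system) (T : 'M[C]_(hdim S) -> 'M[C]_(hdim S')) :
    \bar R :=
  ereal_inf [set (size (gates c))%:R%:E | c in
    [set c : circuit S S' | forall rho, T rho = circuit_channel c rho]].

(* <0| A |0> for A on H_S ⊗ H_S' and |0> in H_S' *)
Definition vacuum_block (S S' : system) (A : 'M[C]_(hdim S * hdim S')) :
    'M[C]_(hdim S) :=
  let z := enum_rank (zero_state S') in
  \matrix_(i, j) A (mxtens_index (i, z)) (mxtens_index (j, z)).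

(* E^x = <0| U^* (|x><x| ⊗ 1_K) U |0> *)
Definition circuit_povm (S S' : system) (c : circuit S S') (x : 'I_(hdim S')) :
    'M[C]_(hdim S) :=
  let U := circuit_mx c in
  vacuum_block (U^t* *m (delta_mx x x *t 1%:M) *m U).

(** * Computational min-entropy and guessing probability

   [N] is the bound on the number of gates. *)

Variables (N : R) (X B : system).

Definition efficient_povms : set ('I_(hdim X) -> 'M[C]_(hdim B)) :=
  [set E | povm E /\ exists c : circuit B X,
    (size (gates c))%:R <= N /\ forall x, E x = circuit_povm c x].

Definition efficient_choi : set 'M[C]_(hdim X * hdim B) :=
  [set F | exists T : {linear 'M[C]_(hdim B) -> 'M[C]_(hdim X)},
    [/\ cptp T, (gate_complexity T <= N%:E)%E & F = choi (adjoint T)]].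

Definition informationally_complete : Prop :=
  real_span efficient_choi =
  [set Y | Y \is hermsymmx /\ exists c : R, ptrace1 Y = (c%:C)%:M].

(* The order of R[i] holds only between numbers whose difference is real; the
   traces below are real for Hermitian Y and Z. *)
Definition le_eff (Y Z : 'M[C]_(hdim X * hdim B)) : Prop :=
  forall F, cone efficient_choi F -> \tr (Y *m F) <= \tr (Z *m F).

Definition Dmax_eff (rho sigma : 'M[C]_(hdim X * hdim B)) : \bar R :=
  ereal_inf [set l%:E | l in
    [set l : R | le_eff rho ((2 `^ l)%:C *: sigma)]].

Definition Hmin_eff (rho : 'M[C]_(hdim X * hdim B)) : \bar R :=
  (- ereal_inf [set Dmax_eff rho (1%:M *t sigma) | sigma in
      [set sigma : 'M[C]_(hdim B) | density sigma]])%E.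

Definition success (p : 'I_(hdim X) -> R) (rho : 'I_(hdim X) -> 'M[C]_(hdim B))
    (E : 'I_(hdim X) -> 'M[C]_(hdim B)) : R :=
  \sum_x p x * complex.Re (\tr (E x *m rho x)).

Definition success_values p rho : set (\bar R) :=
  [set (success p rho E)%:E | E in efficient_povms].

Definition pguess_eff p rho : \bar R := ereal_sup (success_values p rho).

Definition cq_state (p : 'I_(hdim X) -> R) (rho : 'I_(hdim X) -> 'M[C]_(hdim B)) :
    'M[C]_(hdim X * hdim B) :=
  \sum_x (p x)%:C *: (delta_mx x x *t rho x).

End Circuits.

(* with values in \bar R, so that the logarithm of 0 is -oo *)
Definition elog2 (R : realType) (x : \bar R) : \bar R :=
  (lne x * ((ln 2)^-1)%:E)%E.

(* Main.v *)
Require Import Defs.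
From HB Require Import structures.
From mathcomp Require Import all_boot all_order all_algebra.
From mathcomp Require Import all_classical all_reals all_analysis.
From mathcomp Require Import complex mxtens.

(* For F = J(T^* ) with T efficient, Tr[rho_XB F] is the success probability of
   the efficient POVM E^x = T^*(|x><x|), whereas Tr[(1 ⊗ sigma) F] = Tr[sigma] = 1
   because T^* is unital. Hence rho_XB <=_S 2^l (1 ⊗ sigma) says that no efficient
   POVM succeeds with probability more than 2^l, for every state sigma, and no
   duality is needed. Informational completeness only ensures that efficient
   circuits exist.
   The supremum is attained because only finitely many POVMs are efficient,
   although ancillas are unbounded: an ancilla register touched neither by a gate
   nor by the output stays in |0>, so a circuit can be compressed to boundedly many
   registers of bounded dimensions. *)

Set Implicit Arguments.
Unset Strict Implicit.
Unset Printing Implicit Defensive.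

Import Order.TTheory GRing.Theory Num.Theory.

Local Open Scope ring_scope.

(** * Kraus operators and Choi operators *)

Section Kraus.
Local Open Scope complex_scope.
Local Open Scope sesquilinear_scope.
Variable R : realType.
Local Notation C := R[i].

Lemma adjmxE m n (A : 'M[C]_(m, n)) i j : A^t* i j = Num.conj (A j i).
Proof. by rewrite !mxE. Qed.

Lemma adjmx_mul m n p (A : 'M[C]_(m, n)) (B : 'M[C]_(n, p)) :
  (A *m B)^t* = B^t* *m A^t*.
Proof. by rewrite trmx_mul map_mxM. Qed.

Lemma adjmxK m n (A : 'M[C]_(m, n)) : (A^t*)^t* = A.
Proof. by apply/matrixP => i j; rewrite !adjmxE conjCK. Qed.

Lemma adjmx_tens m n p q (A : 'M[C]_(m, n)) (B : 'M[C]_(p, q)) :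
  (A *t B)^t* = A^t* *t B^t*.
Proof. by rewrite trmx_tens map_mxT. Qed.

Lemma hermsymmxP m (A : 'M[C]_m) : reflect (A = A^t*) (A \is hermsymmx).
Proof. by apply: (iffP (is_hermitianmxP _ _ _)); rewrite expr0 scale1r. Qed.

Lemma psd_sum (I : finType) m (A : I -> 'M[C]_m) :
  (forall a, psd (A a)) -> psd (\sum_a A a).
Proof.
move=> hA; split.
  apply/hermsymmxP/matrixP => i j; rewrite adjmxE !summxE rmorph_sum.
  apply: eq_bigr => a _; have /hermsymmxP h := (hA a).1.
  by rewrite {1}h adjmxE.
move=> v; rewrite mulmx_sumr mulmx_suml summxE.
by apply: sumr_ge0 => a _; exact: (hA a).2.
Qed.

Lemma psd_congr m n (A : 'M[C]_m) (V : 'M[C]_(n, m)) :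
  psd A -> psd (V *m A *m V^t*).
Proof.
move=> [/hermsymmxP hA pA]; split.
  by apply/hermsymmxP; rewrite !adjmx_mul adjmxK -hA mulmxA.
by move=> v; have := pA (V^t* *m v); rewrite adjmx_mul adjmxK !mulmxA.
Qed.

Lemma psd_delta m (x : 'I_m) : psd (delta_mx x x : 'M[C]_m).
Proof.
have e : (delta_mx x x : 'M[C]_m) = delta_mx x (0 : 'I_1) *m (delta_mx x (0 : 'I_1))^t*.
  by rewrite trmx_delta map_delta_mx mul_delta_mx.
rewrite e -[X in X *m _]mulmx1; apply: psd_congr; split.
  by apply/hermsymmxP; rewrite trmx1 map_mx1.
by move=> v; rewrite mulmx1 mxE sumr_ge0 // => i _; rewrite adjmxE mulrC mul_conjC_ge0.
Qed.

Lemma mul_delta_mxE p m n (A : 'M[C]_(m, n)) (i : 'I_p) j k l :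
  (delta_mx i j *m A) k l = (k == i)%:R * A j l.
Proof.
rewrite mxE (bigD1 j) //= big1 ?addr0 => [|q qj]; rewrite mxE ?eqxx ?andbT //.
by rewrite (negPf qj) andbF mul0r.
Qed.

Lemma mxtrace_deltal m (A : 'M[C]_m) i j : \tr (delta_mx i j *m A) = A j i.
Proof.
rewrite /mxtrace (bigD1 i) //= big1 ?addr0 => [|k ki]; rewrite mul_delta_mxE.
  by rewrite eqxx mul1r.
by rewrite (negPf ki) mul0r.
Qed.

Lemma psd_diag_ge0 m (A : 'M[C]_m) i : psd A -> 0 <= A i i.
Proof.
move=> [_ /(_ (delta_mx i 0))].
by rewrite trmx_delta map_delta_mx -mulmxA -colE -rowE !mxE.
Qed.

Lemma big_mxtens (V : nmodType) m n (F : 'I_(m * n) -> V) :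
  \sum_i F i = \sum_a \sum_b F (mxtens_index (a, b)).
Proof.
rewrite pair_bigA /= (reindex (@mxtens_index m n)) /=; last first.
  by exists (@mxtens_unindex m n) => k _; rewrite (mxtens_indexK, mxtens_unindexK).
by apply: eq_bigr => -[].
Qed.

Lemma mxtrace_tens m n (A : 'M[C]_m) (B : 'M[C]_n) :
  \tr (A *t B) = \tr A * \tr B.
Proof.
rewrite /mxtrace big_mxtens mulr_suml; apply: eq_bigr => a _.
by rewrite mulr_sumr; apply: eq_bigr => b _; rewrite tensmxE.
Qed.

Lemma mxtens_matrixP m n p q (A B : 'M[C]_(m * n, p * q)) :
  (forall a i b j, A (mxtens_index (a, i)) (mxtens_index (b, j)) =
                   B (mxtens_index (a, i)) (mxtens_index (b, j))) -> A = B.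
Proof.
move=> e; apply/matrixP => i j; rewrite -(mxtens_unindexK i) -(mxtens_unindexK j).
by case: (mxtens_unindex i) => ? ?; case: (mxtens_unindex j).
Qed.

Definition mxtens_block k m (A : 'M[C]_(k * m)) (a b : 'I_k) : 'M[C]_m :=
  \matrix_(i, j) A (mxtens_index (a, i)) (mxtens_index (b, j)).

Lemma mxtens_block_sum k m (A : 'M[C]_(k * m)) :
  A = \sum_a \sum_b delta_mx a b *t mxtens_block A a b.
Proof.
apply: mxtens_matrixP => a i b j.
rewrite summxE (bigD1 a) //= [X in _ + X]big1 => [|c ca]; last first.
  by rewrite summxE big1 // => d _; rewrite tensmxE mxE eq_sym (negPf ca) mul0r.
rewrite addr0 summxE (bigD1 b) //= big1 => [|c cb]; last first.
  by rewrite tensmxE mxE [b == c]eq_sym (negPf cb) andbF mul0r.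
by rewrite addr0 tensmxE !mxE !eqxx mul1r.
Qed.

(** * Maps in Kraus form *)

Section Family.
Variables (I : finType) (m n : nat) (K : I -> 'M[C]_(n, m)).

Definition kraus (A : 'M[C]_m) : 'M[C]_n := \sum_a K a *m A *m (K a)^t*.

Lemma kraus_is_linear : linear kraus.
Proof.
move=> c A B; rewrite /kraus scaler_sumr -big_split /=; apply: eq_bigr => a _.
by rewrite mulmxDr mulmxDl -scalemxAr -scalemxAl.
Qed.

HB.instance Definition _ :=
  GRing.isLinear.Build C 'M[C]_m 'M[C]_n _ kraus kraus_is_linear.

(** Amplification replaces each Kraus operator by [1 ⊗ K a], which reduces complete positivity to
    the fact that congruences preserve positivity. *)
Lemma ampl_kraus k (A : 'M[C]_(k * m)) :
  ampl kraus A = \sum_a (1%:M *t K a) *m A *m (1%:M *t K a)^t*.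
Proof.
have e a : (1%:M *t K a) *m A *m (1%:M *t K a)^t* =
    \sum_b \sum_c delta_mx b c *t (K a *m mxtens_block A b c *m (K a)^t*).
  rewrite {1}[A]mxtens_block_sum mulmx_sumr mulmx_suml.
  apply: eq_bigr => b _; rewrite mulmx_sumr mulmx_suml; apply: eq_bigr => c _.
  by rewrite adjmx_tens !tensmx_mul trmx1 map_mx1 mul1mx mulmx1.
rewrite (eq_bigr _ (fun a _ => e a)) [RHS]exchange_big; apply: eq_bigr => b _ /=.
rewrite [RHS]exchange_big; apply: eq_bigr => c _ /=.
apply: mxtens_matrixP => d i f j.
rewrite tensmxE !summxE mulr_sumr; apply: eq_bigr => a _; rewrite tensmxE.
by rewrite /mxtens_block.
Qed.

Lemma adjoint_kraus Y : adjoint kraus Y = \sum_a (K a)^t* *m Y *m K a.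
Proof.
apply/matrixP => i j; rewrite mxE /kraus mulmx_suml raddf_sum summxE /=.
apply: eq_bigr => a _.
by rewrite -!mulmxA mxtrace_mulC -!mulmxA mxtrace_deltal !mulmxA.
Qed.

Lemma cptp_kraus : \sum_a (K a)^t* *m K a = 1%:M -> cptp kraus.
Proof.
move=> hK; split => [k A pA|A].
  by rewrite ampl_kraus; apply: psd_sum => a; apply: psd_congr.
rewrite /kraus raddf_sum /= -[in RHS](mul1mx A) -hK mulmx_suml raddf_sum /=.
by apply: eq_bigr => a _; rewrite mxtrace_mulC mulmxA.
Qed.

Lemma psd_adjoint_kraus Y : psd Y -> psd (adjoint kraus Y).
Proof.
move=> pY; rewrite adjoint_kraus; apply: psd_sum => a.
by rewrite -{2}(adjmxK (K a)); apply: psd_congr.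
Qed.

(** In the Schrödinger picture the trace is a diagonal entry of a positive operator. This makes
    success probabilities real, so that the real part in [success] loses nothing. *)
Lemma mxtrace_adjoint_kraus_ge0 x rho : psd rho ->
  0 <= \tr (rho *m adjoint kraus (delta_mx x x)).
Proof.
move=> prho; rewrite -adjointP mxtrace_mulC mxtrace_deltal.
by apply: psd_diag_ge0; apply: psd_sum => a; apply: psd_congr.
Qed.

End Family.

Lemma adjoint_is_linear m n (T : 'M[C]_m -> 'M[C]_n) : linear (adjoint T).
Proof.
move=> c A B; apply/matrixP => i j; rewrite !mxE mulmxDr -scalemxAr.
by rewrite mxtraceD mxtraceZ.
Qed.

HB.instance Definition _ m n (T : 'M[C]_m -> 'M[C]_n) :=
  GRing.isLinear.Build C 'M[C]_n 'M[C]_m _ (adjoint T) (@adjoint_is_linear m n T).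

(** The factor [m] cancels the two factors [m^(-1/2)] from [Omega], so the Choi operator is the sum
    of the |a><b| ⊗ S(|a><b|). Both sides of the operator order are evaluated with this formula. *)
Lemma mxtrace_choi m k (S : {linear 'M[C]_m -> 'M[C]_k}) P Q : (0 < m)%N ->
  \tr ((P *t Q) *m choi S) = \sum_a \sum_b P b a * \tr (Q *m S (delta_mx a b)).
Proof.
move=> m0; rewrite /choi /ampl.
have e a b : m%:R *: (\matrix_(i, j) (Omega R m *m (Omega R m)^t*)
    (mxtens_index (a, i)) (mxtens_index (b, j))) = delta_mx a b :> 'M[C]_m.
  have mR0 : (m%:R : R) != 0 by rewrite pnatr_eq0 -lt0n.
  have s0 : (m%:R : R) = Num.sqrt m%:R ^+ 2 by rewrite sqr_sqrtr ?ler0n.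
  have s1 : Num.sqrt (m%:R : R) != 0 by rewrite -sqrf_eq0 -s0.
  have cr (x : R) : Num.conj x%:C = x%:C by exact: conjc_real.
  have O a' i : Omega R m (mxtens_index (a', i)) 0 = ((Num.sqrt (m%:R : R))^-1)%:C * (a' == i)%:R.
    rewrite mxE summxE (bigD1 a') //= big1 => [|c ca].
      (* The only column index is written as a tensor index so that [tensmxE] applies. *)
      rewrite addr0 -[0 : 'I_1](_ : mxtens_index (0 : 'I_1, 0 : 'I_1) = 0) ?tensmxE; last exact/val_inj.
      by rewrite !mxE !eqxx !andbT mul1r eq_sym.
    rewrite -[0 : 'I_1](_ : mxtens_index (0 : 'I_1, 0 : 'I_1) = 0) ?tensmxE; last exact/val_inj.
    by rewrite !mxE eq_sym (negPf ca) mul0r.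
  apply/matrixP => i j; rewrite !mxE big_ord1 adjmxE !O rmorphM /=.
  rewrite cr conjC_nat mulrACA -natrM mulnb mulrA.
  rewrite -[X in X * _](_ : 1 = _) ?mul1r; first by rewrite [a == i]eq_sym [b == j]eq_sym.
  by rewrite -rmorphM /= -[m%:R](rmorph_nat (real_complex R)) -rmorphM /= -expr2 exprVn -s0 mulfV.
rewrite scaler_sumr mulmx_sumr raddf_sum /=; apply: eq_bigr => a _.
rewrite scaler_sumr mulmx_sumr raddf_sum /=; apply: eq_bigr => b _.
set M := (\matrix_(_, _) _).
have -> : m%:R *: (delta_mx a b *t S M) = delta_mx a b *t S (delta_mx a b).
  rewrite -[X in _ = _ *t S X](e a b) linearZ; apply: mxtens_matrixP => c i d j.
  by rewrite [LHS]mxE !tensmxE [X in _ = _ * X]mxE mulrCA.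
by rewrite tensmx_mul mxtrace_tens mxtrace_mulC mxtrace_deltal.
Qed.

End Kraus.

(** * Operators on some of the registers *)

Section States.

Lemma basis_stateP (S : system) (x y : basis_state S) :
  (forall r, x r = y r :> nat) -> x = y.
Proof. by move=> e; apply/ffunP => r; apply/val_inj/e. Qed.

Lemma read_stateE (S S' : system) (w : wiring S S') x r :
  read_state w x r = x (w r) :> nat.
Proof. by rewrite ffunE. Qed.

Definition agree_off (S S' : system) (w : wiring S S') (y x : basis_state S) :=
  [forall r : reg S, (r \in codom w) || (y r == x r)].

Lemma agree_offP (S S' : system) (w : wiring S S') (y x : basis_state S) :
  reflect (forall r, r \notin codom w -> y r = x r) (agree_off w y x).
Proof.
apply: (iffP forallP) => [h r nr|h r]; first by have := h r; rewrite (negPf nr) => /eqP.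
by case: (boolP (r \in codom w)) => //= nr; rewrite (h r nr).
Qed.

Lemma agree_off_refl (S S' : system) (w : wiring S S') x : agree_off w x x.
Proof. exact/agree_offP. Qed.

Lemma agree_off_sym (S S' : system) (w : wiring S S') y x :
  agree_off w y x = agree_off w x y.
Proof. by apply: eq_forallb => r; rewrite [y r == _]eq_sym. Qed.

Lemma agree_off_trans (S S' : system) (w : wiring S S') z y x :
  agree_off w y z -> agree_off w z x = agree_off w y x.
Proof.
move=> /agree_offP h; apply: eq_forallb => r.
by case: (boolP (r \in codom w)) => //= nr; rewrite h.
Qed.

(* The default of [insubd] is never used: [val (t r')] is below [rdim r]. *)
Definition write_state (S S' : system) (w : wiring S S') (t : basis_state S')
    (x : basis_state S) : basis_state S :=
  [ffun r : reg S => if [pick r' | w r' == r] is Some r'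
                     then insubd (x r) (val (t r')) else x r].

Lemma write_state_in (S S' : system) (w : wiring S S') t x r :
  write_state w t x (w r) = t r :> nat.
Proof.
rewrite ffunE; case: pickP => [r' /eqP /wire_inj ->|/(_ r)]; last by rewrite eqxx.
have lt : (t r < rdim (w r))%N by rewrite wire_dim.
by rewrite val_insubd lt.
Qed.

Lemma write_state_off (S S' : system) (w : wiring S S') t x :
  agree_off w (write_state w t x) x.
Proof.
apply/agree_offP => r nr; rewrite ffunE; case: pickP => // r' /eqP e.
by rewrite -e codom_f in nr.
Qed.

Lemma write_stateK (S S' : system) (w : wiring S S') t x :
  read_state w (write_state w t x) = t.
Proof. by apply: basis_stateP => r; rewrite read_stateE write_state_in. Qed.

Lemma eq_state_off (S S' : system) (w : wiring S S') x y :
  agree_off w x y -> read_state w x = read_state w y -> x = y.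
Proof.
move=> /agree_offP h e; apply: basis_stateP => r.
case: (boolP (r \in codom w)) => [/codomP[r' ->]|/h -> //].
by rewrite -!read_stateE e.
Qed.

Lemma read_stateK (S S' : system) (w : wiring S S') x y :
  agree_off w x y -> write_state w (read_state w x) y = x.
Proof.
move=> h; apply: (@eq_state_off _ _ w); last by rewrite write_stateK.
by rewrite -(agree_off_trans (z := y)) ?write_state_off // agree_off_sym.
Qed.

(** States that agree with [x] off [w] correspond to contents of the wired registers, through
    [write_state] and [read_state]. Sums over the large system thus become sums over the small
    one. *)
Lemma sum_agree_off (V : nmodType) (S S' : system) (w : wiring S S') x
    (Q : pred (basis_state S)) (F : basis_state S -> V) :
  \sum_(y | agree_off w y x && Q y) F y =
  \sum_(t | Q (write_state w t x)) F (write_state w t x).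
Proof.
rewrite (reindex_onto (fun t => write_state w t x) (read_state w)) /=.
  by apply: eq_bigl => t; rewrite write_state_off write_stateK eqxx andbT.
by move=> y /andP[/read_stateK].
Qed.

Lemma read_state_comp (S S' S'' : system) (w : wiring S S') (v : wiring S' S'')
    (u : wiring S S'') x : (forall r, w (v r) = u r) ->
  read_state v (read_state w x) = read_state u x.
Proof. by move=> e; apply: basis_stateP => r; rewrite !read_stateE e. Qed.

Lemma agree_off_comp (S S' S'' : system) (w : wiring S S') (v : wiring S' S'')
    (u : wiring S S'') y x : (forall r, w (v r) = u r) ->
  agree_off u y x =
  agree_off w y x && agree_off v (read_state w y) (read_state w x).
Proof.
move=> e; apply/agree_offP/andP => [h|[/agree_offP hw /agree_offP hv] r nr].
  split; apply/agree_offP => r nr.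
    by apply: h; apply: contra nr => /codomP[r' ->]; rewrite -e codom_f.
  apply: val_inj; rewrite /= !read_stateE h //.
  apply: contra nr => /codomP[r']; rewrite -e => /wire_inj ->; exact: codom_f.
case: (boolP (r \in codom w)) => [/codomP[r' er]|/hw //].
apply: val_inj; rewrite er /= -!read_stateE hv //.
by apply: contra nr => /codomP[q eq]; rewrite er eq e codom_f.
Qed.

(** Lets a gate, the input or the outcome be regarded as living on a subsystem. The map [v] is
    chosen registerwise and inherits injectivity from [u]. *)
Lemma wiring_factor (S S' S'' : system) (w : wiring S S') (u : wiring S S'') :
  (forall r, u r \in codom w) ->
  exists v : wiring S' S'', forall r, w (v r) = u r.
Proof.
move=> h.
have /fin_all_exists[v hv] r : exists q, w q = u r.
  by have /codomP[q ->] := h r; exists q.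
have vi : injective v by move=> a b e; apply: (@wire_inj _ _ u); rewrite -!hv e.
have vd r : rdim (v r) = rdim r by rewrite -(wire_dim w) hv wire_dim.
by exists (Wiring vi vd).
Qed.

End States.

(** * Matrices acting on the wired registers and trivially elsewhere *)

Section Lift.
Local Open Scope complex_scope.
Local Open Scope sesquilinear_scope.
Variable R : realType.
Local Notation C := R[i].

Definition entry (S : system) (A : 'M[C]_(hdim S)) (y x : basis_state S) : C :=
  A (enum_rank y) (enum_rank x).

Lemma entry_inj (S : system) (A B : 'M[C]_(hdim S)) :
  (forall y x, entry A y x = entry B y x) -> A = B.
Proof.
move=> e; apply/matrixP => i j.
by have := e (enum_val i) (enum_val j); rewrite /entry !enum_valK.
Qed.

Lemma entry_mul (S : system) (A B : 'M[C]_(hdim S)) y x :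
  entry (A *m B) y x = \sum_z entry A y z * entry B z x.
Proof.
rewrite /entry mxE (reindex (@enum_rank (basis_state S))) //=.
by exists enum_val => z _; rewrite (enum_rankK, enum_valK).
Qed.

Lemma entry1 (S : system) y x : entry (1%:M : 'M[C]_(hdim S)) y x = (y == x)%:R.
Proof. by rewrite /entry mxE (inj_eq enum_rank_inj). Qed.

(** The construction of [apply_gate] for an arbitrary matrix, so that a product of gates on a
    subsystem can be lifted as a whole. *)
Definition lift_mx (S S' : system) (w : wiring S S') (A : 'M[C]_(hdim S')) :
    'M[C]_(hdim S) :=
  \matrix_(i, j)
    let y := enum_val i : basis_state S in let x := enum_val j : basis_state S in
    if agree_off w y x then entry A (read_state w y) (read_state w x) else 0.

Lemma entry_lift (S S' : system) (w : wiring S S') A y x :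
  entry (lift_mx w A) y x =
  if agree_off w y x then entry A (read_state w y) (read_state w x) else 0.
Proof. by rewrite /entry mxE !enum_rankK. Qed.

Lemma apply_gateE (S : system) (g : gate R) (w : wiring S (gsys g)) :
  apply_gate w = lift_mx w (gmx g).
Proof. by []. Qed.

Lemma lift_mx1 (S S' : system) (w : wiring S S') : lift_mx w 1%:M = 1%:M.
Proof.
apply: entry_inj => y x; rewrite entry_lift !entry1.
have [->|ne] := eqVneq y x; first by rewrite agree_off_refl eqxx.
case: ifP => // h; case: eqP => // e; case/eqP: ne; exact: eq_state_off e.
Qed.

Lemma lift_mxM (S S' : system) (w : wiring S S') A B :
  lift_mx w (A *m B) = lift_mx w A *m lift_mx w B.
Proof.
apply: entry_inj => y x; rewrite entry_lift !entry_mul.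
(* Intermediate states that differ from [x] off [w] contribute zero; the others are determined by
   their contents on the wired registers. *)
transitivity (\sum_(z | agree_off w z x && true)
  entry (lift_mx w A) y z * entry (lift_mx w B) z x); last first.
  rewrite [RHS](bigID (agree_off w ^~ x)) /= [X in _ = _ + X]big1 ?addr0 => [|z nz].
    by apply: eq_bigl => z; rewrite andbT.
  by rewrite entry_lift [in X in _ * X]entry_lift (negPf nz) mulr0.
rewrite sum_agree_off /=; case: ifP => h; last first.
  rewrite big1 // => t _; rewrite entry_lift agree_off_sym.
  by rewrite (agree_off_trans (y := x)) 1?agree_off_sym ?write_state_off // h mul0r.
apply: eq_bigr => t _; rewrite !entry_lift write_state_off.
rewrite agree_off_sym (agree_off_trans (y := x)) 1?agree_off_sym ?write_state_off //.
by rewrite h write_stateK.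
Qed.

Lemma lift_mx_adj (S S' : system) (w : wiring S S') A :
  lift_mx w (A^t*) = (lift_mx w A)^t*.
Proof.
apply/matrixP => i j; rewrite !mxE /= agree_off_sym.
by case: ifP => _; rewrite ?rmorph0 // /entry !mxE.
Qed.

Lemma lift_mx_unitary (S S' : system) (w : wiring S S') A :
  A \is unitarymx -> lift_mx w A \is unitarymx.
Proof.
move=> /unitarymxP h; apply/unitarymxP.
by rewrite -(lift_mx_adj w A) -lift_mxM h lift_mx1.
Qed.

Lemma lift_mx_comp (S S' S'' : system) (w : wiring S S') (v : wiring S' S'')
    (u : wiring S S'') A : (forall r, w (v r) = u r) ->
  lift_mx w (lift_mx v A) = lift_mx u A.
Proof.
move=> e; apply: entry_inj => y x.
rewrite !entry_lift (agree_off_comp _ _ e) !(read_state_comp _ e).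
by case: (agree_off w y x).
Qed.

Variables (GI : finType) (G : GI -> gate R).

Lemma apply_gates_unitary (S : system) (s : seq {g : GI & wiring S (gsys (G g))}) :
  apply_gates s \is unitarymx.
Proof.
elim: s => [|[g w] s IH] /=; first by apply/unitarymxP; rewrite trmx1 map_mx1 mulmx1.
by rewrite mul_unitarymx // apply_gateE lift_mx_unitary // gmx_unitary.
Qed.

End Lift.

(** * Channels and POVMs of circuits *)

Section CircuitKraus.
Local Open Scope complex_scope.
Local Open Scope sesquilinear_scope.
Variable R : realType.
Local Notation C := R[i].
Variables (GI : finType) (G : GI -> gate R).
Variables (S S' : system).

(* The Kraus operators (1 ⊗ <a|_K) U (1 ⊗ |0>_E) of the channel of a circuit. *)
Definition circuit_kraus (c : circuit G S S') (a : 'I_(hdim (disc c))) :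
    'M[C]_(hdim S', hdim S) :=
  \matrix_(i, j) circuit_mx c (mxtens_index (i, a))
    (mxtens_index (j, enum_rank (zero_state (anc c)))).

Lemma ket0_projE (A : system) :
  ket0 R A *m (ket0 R A)^t* = delta_mx (enum_rank (zero_state A)) (enum_rank (zero_state A)).
Proof. by rewrite /ket0 trmx_delta map_delta_mx mul_delta_mx. Qed.

(** The ancilla projector leaves only the columns of |0>, and [ptrace2] yields one Kraus operator
    for each basis state of the discarded system. *)
Lemma circuit_channelE (c : circuit G S S') rho :
  circuit_channel c rho = kraus (@circuit_kraus c) rho.
Proof.
apply/matrixP => i j; rewrite /circuit_channel ket0_projE mxE summxE.
set z := enum_rank _; apply: eq_bigr => a _.
rewrite !mxE big_mxtens; apply: eq_bigr => k _.
rewrite (bigD1 z) //= big1 ?addr0 => [|e ne].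
  rewrite !adjmxE [circuit_kraus a j k]mxE -/z; congr (_ * _).
  rewrite !mxE big_mxtens; apply: eq_bigr => l _.
  rewrite (bigD1 z) //= big1 ?addr0 => [|e ne].
    by rewrite tensmxE [delta_mx z z z z]mxE !eqxx mulr1 [circuit_kraus a i l]mxE.
  by rewrite tensmxE [delta_mx z z e z]mxE (negPf ne) !mulr0.
rewrite mxE big_mxtens big1 ?mul0r // => l _; rewrite big1 // => f _.
by rewrite tensmxE [delta_mx z z f e]mxE (negPf ne) andbF !mulr0.
Qed.

(** Measuring after the circuit amounts to pulling |x><x| back through the channel; expanding in the
    basis of the discarded system gives the Kraus form of the adjoint. *)
Lemma circuit_povmE (c : circuit G S S') x :
  circuit_povm c x = adjoint (circuit_channel c) (delta_mx x x).
Proof.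
rewrite (_ : circuit_channel c = kraus (@circuit_kraus c)); last first.
  exact/funext/circuit_channelE.
rewrite adjoint_kraus; apply/matrixP => i j; rewrite mxE summxE mxE big_mxtens.
rewrite exchange_big; apply: eq_bigr => a _ /=.
rewrite mxE; apply: eq_bigr => k _.
rewrite !mxE; congr (_ * _); rewrite big_mxtens.
apply: eq_bigr => l _; rewrite (bigD1 a) //= big1 ?addr0 => [|b ne].
  by rewrite tensmxE !mxE eqxx mulr1.
by rewrite tensmxE !mxE (negPf ne) !mulr0.
Qed.

Lemma join_state_l (S1 S2 : system) (i : 'I_(hdim S1 * hdim S2)) (r : reg S1) :
  join_state i (lshift (nreg S2) r) =
  (enum_val (mxtens_unindex i).1 : basis_state S1) r :> nat.
Proof.
rewrite ffunE.
(* The type of [sum_digit i s] depends on [s], so the value of [fintype.split] is generalized before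
   it is replaced. *)
have gen s : s = inl r -> sum_digit i s =
    (enum_val (mxtens_unindex i).1 : basis_state S1) r :> nat by move=> ->.
exact: gen (unsplitK (inl r)).
Qed.

Lemma join_state_r (S1 S2 : system) (i : 'I_(hdim S1 * hdim S2)) (r : reg S2) :
  join_state i (rshift (nreg S1) r) =
  (enum_val (mxtens_unindex i).2 : basis_state S2) r :> nat.
Proof.
rewrite ffunE.
have gen s : s = inr r -> sum_digit i s =
    (enum_val (mxtens_unindex i).2 : basis_state S2) r :> nat by move=> ->.
exact: gen (unsplitK (inr r)).
Qed.

Lemma rdim_join_l (S1 S2 : system) (r : reg S1) :
  rdim (lshift (nreg S2) r : reg (join S1 S2)) = rdim r.
Proof. by rewrite /= (unsplitK (inl r)). Qed.

Lemma rdim_join_r (S1 S2 : system) (r : reg S2) :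
  rdim (rshift (nreg S1) r : reg (join S1 S2)) = rdim r.
Proof. by rewrite /= (unsplitK (inr r)). Qed.

Definition init_state (A : system) (i : 'I_(hdim S)) : basis_state (join S A) :=
  join_state (mxtens_index (i, enum_rank (zero_state A))).

Lemma init_state_l A i r :
  init_state A i (lshift _ r) = (enum_val i : basis_state S) r :> nat.
Proof. by rewrite join_state_l mxtens_indexK. Qed.

Lemma init_state_r A i r : init_state A i (rshift _ r) = 0%N :> nat.
Proof. by rewrite join_state_r mxtens_indexK enum_rankK /= ffunE. Qed.

Lemma init_state_inj A : injective (init_state A).
Proof.
move=> i j e; apply: enum_val_inj; apply: basis_stateP => r.
by rewrite -!(init_state_l A) e.
Qed.

(* [out c] maps the registers before relabelling to those of X' and K; its inverse
   restricted to X' tells which register carries which digit of the outcome. *)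
Lemma circuit_readout (c : circuit G S S') :
  exists wX : wiring (join S (anc c)) S', forall x i j,
    adjoint (circuit_channel c) (delta_mx x x) i j =
    \sum_(y | read_state wX y == enum_val x)
      Num.conj (entry (apply_gates (gates c)) y (init_state (anc c) i)) *
      entry (apply_gates (gates c)) y (init_state (anc c) j).
Proof.
have [g gK Kg] := out_bij c.
have gd q : rdim (g q) = rdim q by rewrite -(wire_dim (out c)) Kg.
have gi : injective g := can_inj Kg.
pose wX : wiring (join S (anc c)) S' := @Wiring (join S (anc c)) S'
  (fun r => g (lshift _ r)) (fun a b e => @lshift_inj _ _ _ _ (gi _ _ e))
  (fun r => etrans (gd _) (rdim_join_l _ r)).
pose wK : wiring (join S (anc c)) (disc c) := @Wiring (join S (anc c)) (disc c)
  (fun r => g (rshift _ r)) (fun a b e => @rshift_inj _ _ _ _ (gi _ _ e))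
  (fun r => etrans (gd _) (rdim_join_r _ r)).
exists wX => x i j.
(* [h a] is the state of the circuit's registers with readout [x] and discarded part [a]. Reindexing
   along [h] turns the sum over Kraus operators into one over the states with outcome [x]. *)
pose h a := read_state (out c) (join_state (mxtens_index (x, a))).
have hX a : read_state wX (h a) = enum_val x.
  apply: basis_stateP => r; rewrite !read_stateE /= Kg.
  by rewrite join_state_l mxtens_indexK.
have hK a : read_state wK (h a) = enum_val a.
  apply: basis_stateP => r; rewrite !read_stateE /= Kg.
  by rewrite join_state_r mxtens_indexK.
have inj y y' : read_state wX y = read_state wX y' ->
    read_state wK y = read_state wK y' -> y = y'.
  move=> eX eK; apply: basis_stateP => r; rewrite -(gK r).
  case: (split_ordP (out c r)) => q ->.
    by have := read_stateE wX y q; rewrite eX read_stateE.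
  by have := read_stateE wK y q; rewrite eK read_stateE.
rewrite (_ : circuit_channel c = kraus (@circuit_kraus c)); last first.
  exact/funext/circuit_channelE.
rewrite adjoint_kraus summxE (reindex_onto h (fun y => enum_rank (read_state wK y))) /=.
  under [RHS]eq_bigl => a do rewrite hX hK enum_valK !eqxx.
  apply: eq_bigr => a _; rewrite -mulmxA mxE (bigD1 x) //= big1 ?addr0 => [|k ne].
    by rewrite adjmxE mul_delta_mxE !mxE eqxx mul1r.
  by rewrite mul_delta_mxE (negPf ne) mul0r mulr0.
move=> y /eqP ey; apply: inj; first by rewrite hX.
by rewrite hK enum_rankK.
Qed.

(** Summing over outcomes removes the restriction on the readout. What remains are entries of U^* U
    = 1 between initial states, and distinct inputs have distinct initial states. *)
Lemma sum_adjoint_circuit (c : circuit G S S') :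
  \sum_x adjoint (circuit_channel c) (delta_mx x x) = 1%:M.
Proof.
have [wX hX] := circuit_readout c.
apply/matrixP => i j; rewrite summxE (eq_bigr _ (fun x _ => hX x i j)).
rewrite (reindex (@enum_rank (basis_state S'))) /=; last first.
  by exists enum_val => z _; rewrite (enum_rankK, enum_valK).
under eq_bigr => z _ do under eq_bigl => y do rewrite enum_rankK.
have /unitarymxP/mulmx1C U' := apply_gates_unitary (gates c).
transitivity (\sum_y Num.conj (entry (apply_gates (gates c)) y (init_state (anc c) i)) *
    entry (apply_gates (gates c)) y (init_state (anc c) j)).
  by rewrite [RHS](partition_big (read_state wX) xpredT).
transitivity (entry (1%:M : 'M[C]__) (init_state (anc c) i) (init_state (anc c) j)).
  rewrite -U' entry_mul; apply: eq_bigr => y _; congr (_ * _).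
  by rewrite /entry adjmxE.
by rewrite entry1 mxE (inj_eq (@init_state_inj _)).
Qed.

(** Trace preservation is unitality of the adjoint, because the projectors |x><x| sum to 1. *)
Lemma circuit_kraus_tp (c : circuit G S S') :
  \sum_a (@circuit_kraus c a)^t* *m @circuit_kraus c a = 1%:M.
Proof.
rewrite -(sum_adjoint_circuit c) (_ : circuit_channel c = kraus (@circuit_kraus c)).
  under [RHS]eq_bigr => x _ do rewrite adjoint_kraus.
  rewrite exchange_big /=; apply: eq_bigr => a _.
  by rewrite -mulmx_suml -mulmx_sumr -mx1_sum_delta mulmx1.
exact/funext/circuit_channelE.
Qed.

End CircuitKraus.

(** * Finiteness of the efficient POVMs *)

Section Finiteness.
Local Open Scope classical_set_scope.
Local Open Scope complex_scope.
Local Open Scope sesquilinear_scope.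
Variable R : realType.
Local Notation C := R[i].
Variables (GI : finType) (G : GI -> gate R).

(** By proof irrelevance a wiring is determined by its underlying function between finite sets. *)
Lemma finite_wiring (S S' : system) : finite_set [set: wiring S S'].
Proof.
pose f (w : wiring S S') : {ffun reg S' -> reg S} := [ffun r => w r].
have f_inj : injective f.
  move=> [w wi wd] [w' wi' wd'] e; have ew : w = w'.
    by apply/funext => r; have /ffunP/(_ r) := e; rewrite !ffunE.
  by subst w'; congr Wiring; exact: Prop_irrelevance.
rewrite -[setT](preimage_setT f); apply: finite_preimage finite_finset.
by move=> ? ? _ _; exact: f_inj.
Qed.

(** The matrices of products of exactly [k] gates on [S]; there are finitely many, since gates and
    wirings are finite in number. *)
Fixpoint reachable (S : system) k : set 'M[C]_(hdim S) :=
  if k is k'.+1 then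
    \bigcup_g [set lift_mx w (gmx (G g)) *m U | w in [set: wiring S (gsys (G g))]
                                              & U in @reachable S k']
  else [set 1%:M].
Arguments reachable : clear implicits.

Lemma finite_reachable (S : system) k : finite_set (reachable S k).
Proof.
elim: k => [|k IH]; first exact: finite_set1.
by apply: bigcup_finite => [|g _]; [exact: finite_finset|exact/finite_image2/IH/finite_wiring].
Qed.

Definition wired_in (S : system) (pT : predType (reg S)) (A : pT)
    (a : {g : GI & wiring S (gsys (G g))}) : bool :=
  [forall r, projT2 a r \in A].

(** Every gate factors through the subsystem and lifting is multiplicative, so the whole product is
    lifted from it with the same number of gates. *)
Lemma apply_gates_compress (S S' : system) (w : wiring S S')
    (s : seq {g : GI & wiring S (gsys (G g))}) :
  all (wired_in (codom w)) s ->
  exists2 U, reachable S' (size s) U & apply_gates s = lift_mx w U.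
Proof.
elim: s => [_|[g u] s IH /= /andP[/forallP hu /IH[U rU eU]]].
  by exists 1%:M => //; rewrite lift_mx1.
have [v hv] := wiring_factor hu.
exists (lift_mx v (gmx (G g)) *m U); first by exists g => //; exists v => //; exists U.
by rewrite lift_mxM (lift_mx_comp _ hv) eU.
Qed.

(** Each gate adds at most [K] registers to [A0], and wirings preserve dimensions, so [D] bounds the
    added ones too. *)
Lemma touched_registers (S : system) K D (A0 : {set reg S})
    (s : seq {g : GI & wiring S (gsys (G g))}) :
  (forall g, nreg (gsys (G g)) <= K)%N ->
  (forall g (r : reg (gsys (G g))), rdim r <= D)%N ->
  (forall r, r \in A0 -> rdim r <= D)%N ->
  exists A : {set reg S}, [/\ A0 \subset A, (#|A| <= #|A0| + size s * K)%N,
    (forall r, r \in A -> rdim r <= D)%N &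
    all (wired_in A) s].
Proof.
move=> hK hD h0; elim: s => [|[g u] s [A [sA cA dA allA]]].
  by exists A0; split=> //; rewrite mul0n addn0.
exists (A :|: (u @: [set: reg (gsys (G g))]%SET)); split.
- by rewrite subsetU // sA.
- rewrite (leq_trans (leq_card_setU _ _)) // mulSn addnCA addnC leq_add //.
  by rewrite (leq_trans (leq_imset_card _ _)) // cardsT card_ord.
- by move=> r; rewrite inE => /orP[/dA//|/imsetP[q _ ->]]; rewrite wire_dim.
- rewrite /=; apply/andP; split; first by apply/forallP => r; rewrite inE imset_f ?orbT.
  by apply: sub_all allA => a /forallP h; apply/forallP => r; rewrite inE h.
Qed.

(** Storing each dimension minus one makes it positive by construction and leaves finitely many
    systems for given [m] and [D]. *)
Definition ord_system m D (f : {ffun 'I_m -> 'I_D}) : system :=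
  @System m (fun r => (f r).+1) (fun=> isT).

Lemma subsystem (S : system) (A : {set reg S}) D :
  (forall r, r \in A -> rdim r <= D.+1)%N ->
  exists (f : {ffun 'I_#|A| -> 'I_D.+1}) (w : wiring S (ord_system f)),
    forall r, r \in A -> r \in codom w.
Proof.
move=> hD; pose f : {ffun 'I_#|A| -> 'I_D.+1} := [ffun i => inord (rdim (enum_val i)).-1].
have fd (r : reg (ord_system f)) : rdim (enum_val (r : 'I_#|A|)) = rdim r.
  rewrite /= ffunE inordK ?prednK ?rdim_gt0 //.
  exact/hD/enum_valP.
exists f, (@Wiring S (ord_system f) (fun i => enum_val i) (@enum_val_inj _ _) fd).
by move=> r rA; apply/codomP; exists (enum_rank_in rA r); rewrite /= enum_rankK_in.
Qed.

Section Povm.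
Variables (X B : system).

(* The POVM of U on the registers of S alone, with B read in through vB, all other
   registers of S in |0>, and the outcome read out through vX. *)
Definition compressed_povm (S : system) (U : 'M[C]_(hdim S)) (vX : wiring S X)
    (vB : wiring S B) (x : 'I_(hdim X)) : 'M[C]_(hdim B) :=
  \matrix_(i, j) \sum_(y | read_state vX y == enum_val x)
    Num.conj (entry U y (write_state vB (enum_val i) (zero_state S))) *
    entry U y (write_state vB (enum_val j) (zero_state S)).

(** Off [w] the lifted matrix acts as the identity and the initial state is zero. Hence only states
    vanishing off [w] contribute, and these are parametrized by the states of [S]. *)
Lemma circuit_povm_compress (c : circuit G B X) (S : system)
    (w : wiring (join B (anc c)) S) (U : 'M[C]_(hdim S)) (wX : wiring (join B (anc c)) X) :
  apply_gates (gates c) = lift_mx w U ->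
  (forall r, wX r \in codom w) -> (forall r : reg B, lshift _ r \in codom w) ->
  (forall x i j, circuit_povm c x i j =
    \sum_(y | read_state wX y == enum_val x)
      Num.conj (entry (apply_gates (gates c)) y (init_state (anc c) i)) *
      entry (apply_gates (gates c)) y (init_state (anc c) j)) ->
  exists vX vB, circuit_povm c = compressed_povm U vX vB.
Proof.
move=> eU /wiring_factor[vX hX] hB hc.
pose wB : wiring (join B (anc c)) B := @Wiring (join B (anc c)) B (lshift (nreg (anc c)))
  (@lshift_inj _ _) (@rdim_join_l _ _).
have [vB eB] := @wiring_factor _ _ _ w wB hB.
exists vX, vB; apply/funext => x; apply/matrixP => i j; rewrite hc mxE eU.
set yi := init_state _ i; set yj := init_state _ j.
(* Off [w] there are only ancilla registers, which start in |0> whatever the input is. *)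
have agr k l : agree_off w (init_state (anc c) k) (init_state (anc c) l).
  apply/agree_offP => r; case: (split_ordP r) => q -> nr; first by rewrite hB in nr.
  by apply: val_inj; rewrite /= !init_state_r.
have rd k : read_state w (init_state (anc c) k) =
    write_state vB (enum_val k) (zero_state S).
  apply: basis_stateP => r; rewrite read_stateE.
  have [/codomP[q ->]|nr] := boolP (r \in codom vB).
    by rewrite write_state_in eB init_state_l.
  rewrite (agree_offP _ _ _ (write_state_off _ _ _)) //.
  case: (split_ordP (w r)) => q e; rewrite e; last by rewrite init_state_r ffunE.
  by case/negP: nr; apply/codomP; exists q; apply: (@wire_inj _ _ w); rewrite eB.
transitivity (\sum_(y | agree_off w y yi && (read_state wX y == enum_val x))
    Num.conj (entry (lift_mx w U) y yi) * entry (lift_mx w U) y yj).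
  rewrite [LHS](bigID (agree_off w ^~ yi)) /= [X in _ + X]big1 ?addr0 => [|y /andP[_ ny]].
    by apply: eq_bigl => y; rewrite andbC.
  by rewrite entry_lift (negPf ny) conjC0 mul0r.
rewrite sum_agree_off; apply: eq_big => t.
  by rewrite -(read_state_comp _ hX) write_stateK.
have ag : agree_off w (write_state w t yi) yj.
  by rewrite -(agree_off_trans (z := yi)) ?agr ?write_state_off.
by move=> _; rewrite !entry_lift write_state_off ag write_stateK !rd.
Qed.

Lemma finite_circuit_povms (N : nat) :
  finite_set [set circuit_povm c | c in [set c : circuit G B X | (size (gates c) <= N)%N]].
Proof.
(* [K] bounds the registers of one gate, [D] the dimension of every gate, input and output register,
   and [M] the number of registers that the input, the output and [N] gates can involve. *)
pose K := (\max_g nreg (gsys (G g)))%N.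
pose D := (maxn (\max_g \max_(r : reg (gsys (G g))) rdim r)
  (maxn (\max_(r : reg B) rdim r) (\max_(r : reg X) rdim r)))%N.
pose M := (nreg B + nreg X + N * K)%N.
pose F := \bigcup_(m in `I_M.+1) \bigcup_(f : {ffun 'I_m -> 'I_D.+1})
  \bigcup_(k in `I_N.+1) \bigcup_(vX : wiring (ord_system f) X)
    [set compressed_povm U vX vB | U in reachable (ord_system f) k
       & vB in [set: wiring (ord_system f) B]].
apply: (@sub_finite_set _ _ F); last first.
  do 3![apply: bigcup_finite => [|? _]; first exact: finite_II || exact: finite_finset].
  apply: bigcup_finite => [|? _]; first exact: finite_wiring.
  by apply: finite_image2; [exact: finite_reachable|exact: finite_wiring].
move=> _ [c /= sN <-].
have [wX hX] := circuit_readout c.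
pose A0 : {set reg (join B (anc c))} :=
  (@lshift (nreg B) (nreg (anc c)) @: [set: reg B]%SET) :|: (wX @: [set: reg X]%SET).
have hg g (r : reg (gsys (G g))) : (rdim r <= D)%N.
  rewrite leq_max; apply/orP; left.
  apply: leq_trans (leq_bigmax (F := fun g => \max_(r : reg (gsys (G g))) rdim r)%N g).
  exact: (leq_bigmax (F := fun r : reg (gsys (G g)) => rdim r)).
have h0 r : r \in A0 -> (rdim r <= D)%N.
  rewrite inE => /orP[] /imsetP[q _ ->]; rewrite !leq_max.
    by rewrite rdim_join_l (leq_bigmax (F := fun r : reg B => rdim r)) orbT.
  by rewrite wire_dim (leq_bigmax (F := fun r : reg X => rdim r)) !orbT.
have [A [sA cA dA allA]] := touched_registers (gates c)
  (fun g => leq_bigmax (F := fun g => nreg (gsys (G g))) g) hg h0.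
(* The dimension bound is weakened to a successor, the form that [subsystem] takes. *)
have [f [w hw]] := subsystem (fun r rA => leqW (dA r rA)).
have all_w : all (wired_in (codom w)) (gates c).
  by apply: sub_all allA => a /forallP h; apply/forallP => r; apply/hw/h.
have [U rU eU] := apply_gates_compress all_w.
have [r|r|x i j|vX [vB e]] := circuit_povm_compress (wX := wX) eU.
- by apply/hw/(fintype.subsetP sA); rewrite inE imset_f ?orbT.
- by apply/hw/(fintype.subsetP sA); rewrite inE imset_f.
- by rewrite circuit_povmE hX.
exists #|A|; last exists f => //.
  rewrite /= ltnS (leq_trans cA) // leq_add ?leq_mul //.
  rewrite (leq_trans (leq_card_setU _ _)) // leq_add //.
    by rewrite (leq_trans (leq_imset_card _ _)) // cardsT card_ord.
  by rewrite (leq_trans (leq_imset_card _ _)) // cardsT card_ord.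
exists (size (gates c)) => //; exists vX => //.
by exists U => //; exists vB.
Qed.

End Povm.
End Finiteness.

(** * Guessing probability and min-entropy *)

Section Extended.
Local Open Scope classical_set_scope.
Variable R : realType.

Lemma ereal_sup_finite_mem (A : set (\bar R)) :
  finite_set A -> A !=set0 -> A (ereal_sup A).
Proof.
move=> /finite_seqP[s ->] [x xs].
suff [m ms mu] : exists2 m, m \in s & forall y, y \in s -> (y <= m)%E.
  rewrite (_ : ereal_sup _ = m) //; apply/le_anti/andP; split.
    by apply: ge_ereal_sup => y /mu.
  exact: ereal_sup_ubound.
elim: s x xs => [//|z s IH] x _.
case: s IH => [_|y s IH]; first by exists z; rewrite ?mem_head // => y; rewrite inE => /eqP ->.
have [m ms mu] := IH y (mem_head _ _).
have [zm|/ltW mz] := leP z m.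
  exists m; first by rewrite inE ms orbT.
  by move=> t; rewrite inE => /orP[/eqP ->//|/mu].
exists z; first exact: mem_head.
by move=> t; rewrite inE => /orP[/eqP ->//|/mu tm]; exact: le_trans mz.
Qed.

(** For [s <= 0] every real exponent is admissible and both sides are -oo; for [s > 0] the infimum
    is attained at [ln s / ln 2]. *)
Lemma ereal_inf_powR2 (s : R) :
  ereal_inf [set l%:E | l in [set l | s <= 2 `^ l]] = elog2 s%:E.
Proof.
have l2 : 0 < ln (2 : R) by rewrite ln_gt0 // ltr1n.
have [s0|s0] := leP s 0.
  rewrite /elog2 /= s0 gt0_mulNye ?lte_fin ?invr_gt0 //.
  rewrite -ereal_inf_real; congr ereal_inf; apply/seteqP; split=> _ [l _ <-]; exists l => //=.
  by rewrite (le_trans s0) // powR_ge0.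
rewrite /elog2 /= leNgt s0 /= -EFinM; apply/le_anti/andP; split.
  apply: ereal_inf_lbound; exists (ln s / ln 2) => //=.
  by rewrite /powR pnatr_eq0 /= mulfVK ?gt_eqF // lnK.
apply: le_ereal_inf_tmp => _ [l /= sl <-]; rewrite lee_fin ler_pdivrMr //.
rewrite -ln_powR ler_ln // posrE powR_gt0 //.
Qed.

End Extended.

(** * From efficient circuits to the min-entropy *)

Section Guessing.
Local Open Scope classical_set_scope.
Local Open Scope complex_scope.
Local Open Scope sesquilinear_scope.
Variable R : realType.
Local Notation C := R[i].
Variables (GI : finType) (G : GI -> gate R) (N : R) (X B : system).

Lemma hdim_gt0 (S : system) : (0 < hdim S)%N.
Proof. by apply/card_gt0P; exists (zero_state S). Qed.

Lemma complex_ge0E (z : C) : 0 <= z -> z = (complex.Re z)%:C.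
Proof. by case: z => a b; rewrite lecE /= => /andP[/eqP -> _]. Qed.

Lemma gate_complexity_le (T : 'M[C]_(hdim B) -> 'M[C]_(hdim X)) :
  (gate_complexity G T <= N%:E)%E <->
  exists2 c : circuit G B X, (size (gates c))%:R <= N &
    forall rho, T rho = circuit_channel c rho.
Proof.
split=> [h|[c sc cT]]; last first.
  apply: ge_ereal_inf; exists (size (gates c))%:R%:E; last by rewrite lee_fin.
  by exists c.
have N0 : 0 <= N.
  rewrite -lee_fin; apply: le_trans h; apply: le_ereal_inf_tmp => _ [c _ <-].
  by rewrite lee_fin.
(* Gate counts are integers. The infimum lies strictly below the integer part of [N] plus one, so
   some circuit has a count below that, hence at most [N]. *)
have : (gate_complexity G T < (Num.truncn N).+1%:R%:E)%E.
  by apply: le_lt_trans h _; rewrite lte_fin -truncn_le_nat.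
move=> /ereal_inf_lt[_ [c cT <-]]; rewrite lte_fin ltr_nat ltnS => sc.
by exists c => //; rewrite (le_trans _ (_ : (Num.truncn N)%:R <= N)) ?ler_nat ?truncn_le.
Qed.

(** Channels of circuits are CPTP by their Kraus form, so efficient Choi operators are indexed by
    circuits, just as efficient POVMs are. *)
Lemma efficient_choiE :
  @efficient_choi _ _ G N X B = [set choi (adjoint (circuit_channel c)) | c in
    [set c : circuit G B X | (size (gates c))%:R <= N]].
Proof.
apply/seteqP; split=> [F [T [_ /gate_complexity_le[c sc cT] ->]]|_ [c sc <-]].
  by exists c => //; congr (choi (adjoint _)); apply/esym/funext.
have e : circuit_channel c = kraus (@circuit_kraus _ _ _ _ _ c).
  exact/funext/circuit_channelE.
exists (kraus (@circuit_kraus _ _ _ _ _ c)); split; last by rewrite e.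
  exact/cptp_kraus/circuit_kraus_tp.
by apply/gate_complexity_le; exists c => // rho; rewrite circuit_channelE.
Qed.

Lemma efficient_povmsE :
  @efficient_povms _ _ G N X B = [set circuit_povm c | c in
    [set c : circuit G B X | (size (gates c))%:R <= N]].
Proof.
apply/seteqP; split=> [E [_ [c [sc cE]]]|_ [c sc <-]].
  by exists c => //; apply/esym/funext.
split; last by exists c.
split=> [x|]; last by under eq_bigr do rewrite circuit_povmE; exact: sum_adjoint_circuit.
rewrite circuit_povmE (_ : circuit_channel c = kraus (@circuit_kraus _ _ _ _ _ c)).
  exact/psd_adjoint_kraus/psd_delta.
exact/funext/circuit_channelE.
Qed.

Lemma mxtrace_povm_ge0 (c : circuit G B X) x rho : psd rho ->
  0 <= \tr (rho *m circuit_povm c x).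
Proof.
rewrite circuit_povmE (_ : circuit_channel c = kraus (@circuit_kraus _ _ _ _ _ c)).
  exact: mxtrace_adjoint_kraus_ge0.
exact/funext/circuit_channelE.
Qed.

(** The classical part selects the diagonal blocks, where the adjoint channel takes |x><x| to the
    POVM element of [x]. *)
Lemma mxtrace_cq_choi (c : circuit G B X) (p : 'I_(hdim X) -> R)
    (rho : 'I_(hdim X) -> 'M[C]_(hdim B)) : (forall x, psd (rho x)) ->
  \tr (cq_state p rho *m choi (adjoint (circuit_channel c))) =
  (success p rho (circuit_povm c))%:C.
Proof.
move=> prho; rewrite /cq_state mulmx_suml raddf_sum /success rmorph_sum /=.
apply: eq_bigr => x _; rewrite -scalemxAl mxtraceZ mxtrace_choi ?hdim_gt0 //.
rewrite rmorphM /= (mxtrace_mulC (circuit_povm c x)) -complex_ge0E; last exact: mxtrace_povm_ge0.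
congr (_ * _); rewrite (bigD1 x) //= (bigD1 x) //= !big1 => [|a ne|b ne].
- by rewrite !addr0 mxE !eqxx mul1r circuit_povmE.
- by rewrite big1 // => b _; rewrite mxE (negPf ne) andbF mul0r.
- by rewrite mxE (negPf ne) mul0r.
Qed.

(** The identity on X selects the diagonal blocks, and the POVM elements found there sum to 1. *)
Lemma mxtrace_marginal_choi (c : circuit G B X) (sigma : 'M[C]_(hdim B)) :
  \tr ((1%:M *t sigma) *m choi (adjoint (circuit_channel c))) = \tr sigma.
Proof.
rewrite mxtrace_choi ?hdim_gt0 // -[in RHS](mulmx1 sigma) -(sum_adjoint_circuit c).
rewrite mulmx_sumr raddf_sum /=; apply: eq_bigr => a _.
rewrite (bigD1 a) //= big1 => [|b ne]; first by rewrite addr0 mxE eqxx mul1r.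
by rewrite mxE (negPf ne) mul0r.
Qed.

(** Nonnegative combinations preserve the inequality, so the operators satisfying it form a convex
    cone and testing generators suffices. *)
Lemma le_eff_efficient_choi (Y Z : 'M[C]_(hdim X * hdim B)) :
  le_eff G N Y Z <->
  forall F, @efficient_choi _ _ G N X B F -> \tr (Y *m F) <= \tr (Z *m F).
Proof.
split=> [h F hF|h F]; first by apply: h; exact: sub_gen_smallest.
apply: (@smallest_sub _ _ _ [set F | \tr (Y *m F) <= \tr (Z *m F)]) => //.
split=> [|a b F1 F2 a0 b0 h1 h2] /=.
  by rewrite !mulmx0.
have cge0 (r : R) : 0 <= r -> 0 <= (r%:C : C) by move=> r0; rewrite lecR.
rewrite !mulmxDr -!scalemxAr !mxtraceD !mxtraceZ.
by apply: lerD; apply: ler_wpM2l => //; apply: cge0.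
Qed.

(** Without efficient circuits the span would be {0}, whereas informational completeness puts the
    identity in it, as tr_X 1 = |X| 1. *)
Lemma efficient_povms_neq0 : informationally_complete G N X B ->
  @efficient_povms _ _ G N X B !=set0.
Proof.
move=> hIC; have [[F]|] := pselect (@efficient_choi _ _ G N X B !=set0).
  by rewrite efficient_choiE efficient_povmsE => -[c sc _]; exists (circuit_povm c), c.
move=> /set0P/negP; rewrite negbK => /eqP e0.
have : real_span (@efficient_choi _ _ G N X B) 1%:M.
  rewrite hIC /=; split; first exact: hermitian1mx_subproof.
  exists (hdim X)%:R; apply/matrixP => i j; rewrite !mxE.
  under eq_bigr => a _ do rewrite mxE (can_eq (@mxtens_indexK _ _)) xpair_eqE eqxx /=.
  by rewrite sumr_const card_ord rmorph_nat mulrnAC.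
have sub0 : real_subspace [set (0 : 'M[C]_(hdim X * hdim B))].
  by split=> // a b A' B' -> ->; rewrite !scaler0 addr0.
rewrite e0 => /(smallest_sub sub0 (@sub0set _ _)) /matrixP.
pose k := mxtens_index (Ordinal (hdim_gt0 X), Ordinal (hdim_gt0 B)).
by move=> /(_ k k)/eqP; rewrite !mxE eqxx oner_eq0.
Qed.

Lemma pguess_eff_mem (p : 'I_(hdim X) -> R)
    (rho : 'I_(hdim X) -> 'M[C]_(hdim B)) :
  informationally_complete G N X B ->
  success_values G N p rho (pguess_eff G N p rho).
Proof.
move=> hIC; apply: ereal_sup_finite_mem; last first.
  by have [E hE] := efficient_povms_neq0 hIC; exists (success p rho E)%:E, E.
apply: finite_image; rewrite efficient_povmsE.
apply: sub_finite_set (finite_circuit_povms G X B (Num.truncn N)).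
move=> _ [c sc <-]; exists c => //=.
by rewrite -ltnS -(ltr_nat R) (le_lt_trans sc) // -truncn_le_nat.
Qed.

Lemma Dmax_eff_cq (p : 'I_(hdim X) -> R)
    (rho : 'I_(hdim X) -> 'M[C]_(hdim B)) sigma :
  informationally_complete G N X B ->
  (forall x, psd (rho x)) -> \tr sigma = 1 ->
  Dmax_eff G N (cq_state p rho) (1%:M *t sigma) = elog2 (pguess_eff G N p rho).
Proof.
move=> hIC prho tr1.
have [E hE eE] := pguess_eff_mem p rho hIC.
have ub E' : @efficient_povms _ _ G N X B E' -> success p rho E' <= success p rho E.
  move=> hE'; rewrite -lee_fin eE; apply: ereal_sup_ubound; by exists E'.
rewrite -eE -ereal_inf_powR2 /Dmax_eff; congr ereal_inf; congr image.
(* Both sets consist of the [l] for which the optimal success probability is at most 2^l: one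
   inclusion tests the order on the Choi operator of the optimal circuit, the other uses that [E] is
   optimal. *)
apply/seteqP; split=> l /=.
  move=> /le_eff_efficient_choi h.
  move: hE; rewrite efficient_povmsE => -[c sc <-].
  have /h : @efficient_choi _ _ G N X B (choi (adjoint (circuit_channel c))).
    by rewrite efficient_choiE; exists c.
  rewrite mxtrace_cq_choi // -scalemxAl mxtraceZ mxtrace_marginal_choi tr1 mulr1.
  by rewrite lecR.
move=> h; apply/le_eff_efficient_choi => F; rewrite efficient_choiE => -[c sc <-].
rewrite mxtrace_cq_choi // -scalemxAl mxtraceZ mxtrace_marginal_choi tr1 mulr1 lecR.
by apply: le_trans h; apply: ub; rewrite efficient_povmsE; exists c.
Qed.

End Guessing.

Theorem mainTheorem2 (R : realType) (GI : finType) (G : GI -> gate R)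
    (P : {poly R}) (n : nat) (X B : system)
    (hIC : informationally_complete G P.[n%:R] X B)
    (p : 'I_(hdim X) -> R) (rho : 'I_(hdim X) -> 'M[R[i]]_(hdim B))
    (hp0 : forall x, 0 <= p x) (hp1 : \sum_x p x = 1)
    (hrho : forall x, density (rho x)) :
  (* the supremum defining the guessing probability is a maximum *)
  success_values G P.[n%:R] p rho (pguess_eff G P.[n%:R] p rho) /\
  Hmin_eff G P.[n%:R] (cq_state p rho)
    = (- elog2 (pguess_eff G P.[n%:R] p rho))%E.
Proof.
split; first exact: pguess_eff_mem.
rewrite /Hmin_eff; congr (- _)%E.
(* The divergence has the same value for every state sigma, so the infimum is that of a constant
   over a nonempty set; any [rho x] shows that a state exists. *)
rewrite -[RHS](@ereal_inf_cst _ _ _ [set sigma : 'M[R[i]]_(hdim B) | density sigma]%classic).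
  congr ereal_inf; apply: eq_imagel => sigma [_ tr1].
  by rewrite Dmax_eff_cq // => x; have [] := hrho x.
by apply/set0P; exists (rho (Ordinal (hdim_gt0 X))); exact: hrho.
Qed.
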